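(* Let $n=6k+4$ with $k\ge 6$, and let $P(n,3)$ be the generalized Petersen graph with vertex set $\{u_1,\dots,u_n,v_1,\dots,v_n\}$ and edge set $\{u_iu_{i+1},\,u_iv_i,\,v_iv_{i+3}:1\le i\le n\}$ (subscripts modulo $n$). Then $\dim(P(n,3))\ge 4$.
   Context: For a connected graph $G$, an ordered set $W=\{w_1,\dots,w_m\}\subseteq V(G)$ is a resolving set if the vectors $r(z|W)=(d(z,w_1),\dots,d(z,w_m))$ of shortest-path distances are pairwise distinct over all $z\in V(G)$. The metric dimension $\dim(G)$ is the minimum cardinality of a resolving set of $G$. *)

(* Defs.v *)
From mathcomp Require Import all_boot.

Set Implicit Arguments.
Unset Strict Implicit.
Unset Printing Implicit Defensive.

(* Finite graphs are adjacency relations [e : rel T] on a finite vertex type. *)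

Section Metric.
Variables (T : finType) (e : rel T).

Definition walk (d : nat) (x y : T) : bool :=
  [exists p : d.-tuple T, path e x p && (last x p == y)].

(* A shortest path has fewer than #|T| edges, so the search is bounded;       *)
(* disconnected vertices get the junk value #|T|, see [distP], [dist_min].    *)
Definition dist (x y : T) : nat := find (fun d => walk d x y) (iota 0 #|T|).

Definition repr_vec (W : seq T) (z : T) : seq nat := [seq dist z w | w <- W].

Definition resolving (W : seq T) : bool :=
  uniq W && injectiveb (repr_vec W).

Lemma walkP d x y :
  reflect (exists p, [/\ path e x p, last x p = y & size p = d]) (walk d x y).
Proof.
apply: (iffP existsP) => [[p /andP[ep /eqP lp]]|[p [ep lp sp]]].
  by exists p; rewrite size_tuple.
have sp' : size p == d by apply/eqP.
by exists (Tuple sp') => /=; rewrite ep lp eqxx.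
Qed.

Lemma dist_min d x y : walk d x y -> dist x y <= d.
Proof.
move=> w; case: (ltnP d #|T|) => [dT|Td]; last first.
  by apply: leq_trans Td; rewrite -[leqRHS](size_iota 0) find_size.
rewrite leqNgt; apply/negP => lt_d.
by have := before_find 0 lt_d; rewrite nth_iota // add0n w.
Qed.

Lemma distP x y : connect e x y -> walk (dist x y) x y.
Proof.
case/connectP => p ep ->; case/shortenP: ep => p' ep' up' _.
have wp : walk (size p') x (last x p') by apply/walkP; exists p'.
have sp : size p' < #|T| by rewrite -[_.+1]/(size (x :: p')) -(card_uniqP up') max_card.
have hs : has (fun d => walk d x (last x p')) (iota 0 #|T|).
  by apply/hasP; exists (size p'); rewrite ?mem_iota.
by have := nth_find 0 hs; rewrite nth_iota // -[ltnRHS](size_iota 0) -has_find.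
Qed.

Lemma dist0 x y : (dist x y == 0) = (x == y).
Proof.
apply/idP/eqP => [/eqP d0|->]; last first.
  by rewrite -leqn0; apply: dist_min; apply/walkP; exists [::].
have T0 : 0 < #|T| by apply/card_gt0P; exists x.
have hs : has (fun d => walk d x y) (iota 0 #|T|).
  by rewrite has_find size_iota -[find _ _]/(dist x y) d0.
have := nth_find 0 hs; rewrite -[find _ _]/(dist x y) d0 nth_iota //.
by case/walkP => p [_ <- /size0nil ->].
Qed.

Lemma resolving_enum : resolving (enum T).
Proof.
rewrite /resolving enum_uniq; apply/injectiveP => x y /eq_in_map/(_ x).
rewrite mem_enum => /(_ isT) dxy.
by apply/esym/eqP; rewrite -dist0 -dxy dist0.
Qed.

Lemma ex_resolving : exists m, [exists W : m.-tuple T, resolving W].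
Proof.
exists (size (enum T)); apply/existsP.
by exists (in_tuple (enum T)); apply: resolving_enum.
Qed.

Definition metric_dim : nat := ex_minn ex_resolving.

End Metric.

(* inl i is u_i and inr i is v_i, with indices 0, ..., n - 1. *)
Definition petersen_arc (n m : nat) (x y : 'I_n + 'I_n) : bool :=
  match x, y with
  | inl i, inl j => j == (i + 1) %% n :> nat
  | inl i, inr j => i == j
  | inr i, inr j => j == (i + m) %% n :> nat
  | inr _, inl _ => false
  end.

Definition petersen (n m : nat) : rel ('I_n + 'I_n)%type :=
  fun x y => petersen_arc m x y || petersen_arc m y x.

Lemma petersen_sym n m : symmetric (@petersen n m).
Proof. by move=> x y; rewrite /petersen orbC. Qed.

Lemma petersen_irr n m : 1 < n -> ~~ (n %| m) -> irreflexive (@petersen n m).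
Proof.
move=> n1 nm [] i; rewrite /petersen /petersen_arc orbb; apply/negP => /eqP h.
- have /eqP : i + 1 = i + 0 %[mod n] by rewrite addn0 -h modn_small.
  by rewrite eqn_modDl mod0n modn_small.
- have /eqP : i + m = i + 0 %[mod n] by rewrite addn0 -h modn_small.
  by rewrite eqn_modDl mod0n -/(dvdn n m) (negbTE nm).
Qed.

Lemma petersen_connected n m x y : connect (@petersen n m) x y.
Proof.
have cs : connect_sym (@petersen n m).
  exact/sym_connect_sym/petersen_sym.
have n0 : 0 < n by case: x => i; apply: leq_ltn_trans (ltn_ord i).
suff h z : connect (@petersen n m) (inl (Ordinal n0)) z.
  by apply: connect_trans (h y); rewrite cs.
have hu j (jn : j < n) : connect (@petersen n m) (inl (Ordinal n0)) (inl (Ordinal jn)).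
  elim: j jn => [|j IH] jn; first by rewrite (bool_irrelevance jn n0).
  apply: connect_trans (IH (ltnW jn)) (connect1 _).
  by rewrite /petersen /= addn1 modn_small // eqxx.
case: z => -[j jn] //; apply: connect_trans (hu j jn) (connect1 _).
by rewrite /petersen /= eqxx.
Qed.

(* Main.v *)
Require Import Defs.
From mathcomp Require Import all_boot zify.

(* Distances in P(n, 3) are the minimum of an explicit function of the index
   difference t and of n - t. Rotate three landmarks so that the first has
   index 3. Then some pair of vertices close to the first landmark, or close to
   its antipode, is resolved by none of the three. For k = 6 this is a finite
   computation. Passing from k to k + 1 inserts three indices in each of the two
   arcs between the first landmark and its antipode, which shifts the distances
   from a given landmark to all the vertices near the first landmark by a common
   constant, and likewise near its antipode; so each landmark for k + 1 leaves
   unresolved all the candidate pairs that some landmark for k does. *)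

Set Implicit Arguments.
Unset Strict Implicit.
Unset Printing Implicit Defensive.

(** * Distances in P(n, 3) *)

(** Descent along [f] yields a walk of length [f x] to [y]; as [f] drops by at most 1 per edge, no
    walk is shorter. *)
Lemma dist_eqP (T : finType) (e : rel T) (f : T -> nat) (y : T) :
    (forall x, f x = 0 <-> x = y) ->
    (forall x z, e x z -> f x <= (f z).+1) ->
    (forall x, 0 < f x -> exists2 z, e x z & f z < f x) ->
  forall x, dist e x y = f x.
Proof.
move=> f0 fL fD x.
have walk_f m : forall z, f z <= m -> walk e (f z) z y.
  elim: m => [|m IHm] z fz; have [fz0|fz0] := posnP (f z).
  - by rewrite fz0; apply/walkP; exists [::]; split=> //; apply/f0.
  - by move: fz; rewrite leqNgt fz0.
  - by rewrite fz0; apply/walkP; exists [::]; split=> //; apply/f0.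
  have [z' ezz' lt_z'] := fD z fz0.
  have /walkP[p [ep lp sp]] := IHm z' ltac:(lia).
  apply/walkP; exists (z' :: p); rewrite /= ezz' ep lp sp; split=> //.
  by have := fL _ _ ezz'; lia.
have lip p : forall z, path e z p -> f z <= f (last z p) + size p.
  elim: p => [|z' p IHp] z /=; first by rewrite addn0.
  by case/andP=> /fL le_z /IHp; lia.
have wx := walk_f _ x (leqnn _).
have cxy : connect e x y.
  by case/walkP: wx => p [ep <- _]; apply/connectP; exists p.
apply/eqP; rewrite eqn_leq dist_min //=.
case/walkP: (distP cxy) => p [ep lp sp].
by have := lip p x ep; rewrite lp sp (f0 y).2.
Qed.

(* The distance between two vertices of types a and b whose indices differ by t
   when the indices run through the integers; true stands for the inner
   vertices v_i. The [minn 2 (2 * _)] is the cost of visiting the outer cycle. *)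
Definition linear_dist (a b : bool) (t : nat) : nat :=
  if a && b then t %/ 3 + t %% 3 + minn 2 (2 * (t %% 3))
  else if a || b then (t %/ 3 + t %% 3).+1
  else minn t (t %/ 3 + t %% 3).+2.

Definition cyclic_dist (n : nat) (a b : bool) (t : nat) : nat :=
  minn (linear_dist a b t) (linear_dist a b (n - t)).

Lemma linear_dist0 a b t : linear_dist a b t = 0 <-> (a = b /\ t = 0).
Proof.
split=> [|[-> ->]]; last by case: b.
case: a b => -[]; rewrite /linear_dist /= => ?; try lia; split=> //; lia.
Qed.

(** Monotonicity fails locally: between inner vertices, residue 2 modulo 3 costs 4 more than residue
    0. A gap of 10 lets the quotient absorb this. *)
Lemma linear_dist_le a b s t : s + 10 <= t -> linear_dist a b s <= linear_dist a b t.
Proof. case: a b => -[]; rewrite /linear_dist /=; lia. Qed.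

(** From [t = 3] on, the route along inner edges attains the minimum between outer vertices too, so
    three more indices cost one inner edge. *)
Lemma linear_distD3 a b t : 3 <= t -> linear_dist a b (t + 3) = (linear_dist a b t).+1.
Proof. case: a b => -[]; rewrite /linear_dist /=; lia. Qed.

Lemma linear_dist_spoke a b t : linear_dist a b t <= (linear_dist (~~ a) b t).+1.
Proof. case: a b => -[]; rewrite /linear_dist /=; lia. Qed.

Definition stride (a : bool) := if a then 3 else 1.

Lemma linear_dist_rim a b t :
  linear_dist a b t <= (linear_dist a b (t + stride a)).+1 /\
  linear_dist a b (t + stride a) <= (linear_dist a b t).+1.
Proof. case: a b => -[]; rewrite /linear_dist /stride /=; lia. Qed.

Lemma linear_dist_desc a b t : 0 < linear_dist a b t ->
  linear_dist (~~ a) b t < linear_dist a b t \/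
  stride a <= t /\ linear_dist a b (t - stride a) < linear_dist a b t.
Proof. case: a b => -[]; rewrite /linear_dist /stride /=; lia. Qed.

Lemma cyclic_dist_rim n a b t : 20 <= n -> t < n ->
  cyclic_dist n a b t <= (cyclic_dist n a b ((t + stride a) %% n)).+1 /\
  cyclic_dist n a b ((t + stride a) %% n) <= (cyclic_dist n a b t).+1.
Proof.
move=> n20 tn; have [lt_n|le_n] := ltnP (t + stride a) n.
  rewrite modn_small // /cyclic_dist.
  have := linear_dist_rim a b t; have := linear_dist_rim a b (n - (t + stride a)).
  by rewrite subnDA subnK; lia.
have -> : (t + stride a) %% n = t + stride a - n.
  rewrite -{1}(subnK le_n) modnDr modn_small //.
  case: (a) => /=; lia.
(* The edge crosses the origin: both short arcs have length at most 3, and [20 <= n] keeps the long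
   arcs from being cheaper. *)
rewrite /cyclic_dist.
case: a b le_n => -[]; rewrite /linear_dist /stride /= => le_n.
all: by split; lia.
Qed.

Lemma cyclic_distC n a b t : t <= n -> cyclic_dist n a b (n - t) = cyclic_dist n a b t.
Proof. by move=> tn; rewrite /cyclic_dist subKn // minnC. Qed.

Lemma cyclic_dist0 n a b t : t < n -> cyclic_dist n a b t = 0 <-> a = b /\ t = 0.
Proof.
move=> tn; rewrite /cyclic_dist; have [F0 F0'] := linear_dist0 a b t.
have [Fn _] := linear_dist0 a b (n - t).
split=> [/eqP|/F0' ->]; last by rewrite min0n.
case: leqP => _ /eqP; first exact: F0.
by move/Fn => [_]; lia.
Qed.

Lemma cyclic_dist_spoke n a b t :
  cyclic_dist n a b t <= (cyclic_dist n (~~ a) b t).+1.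
Proof.
have := linear_dist_spoke a b t; have := linear_dist_spoke a b (n - t).
by rewrite /cyclic_dist; lia.
Qed.

Lemma cyclic_dist_desc n a b t : t < n -> 0 < cyclic_dist n a b t ->
  [\/ cyclic_dist n (~~ a) b t < cyclic_dist n a b t,
      stride a <= t /\ cyclic_dist n a b (t - stride a) < cyclic_dist n a b t |
      cyclic_dist n a b ((t + stride a) %% n) < cyclic_dist n a b t].
Proof.
move=> tn; have [le_t|lt_t] := leqP (linear_dist a b t) (linear_dist a b (n - t)).
  have -> : cyclic_dist n a b t = linear_dist a b t by rewrite /cyclic_dist; lia.
  case/linear_dist_desc => [lt|[st lt]]; [apply: Or31 | apply: Or32; split=> //];
  by rewrite /cyclic_dist; lia.
have -> : cyclic_dist n a b t = linear_dist a b (n - t) by rewrite /cyclic_dist; lia.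
case/linear_dist_desc => [lt|[st lt]]; [apply: Or31 | apply: Or33].
  by rewrite /cyclic_dist; lia.
rewrite -subnDA in lt.
have [t_n|] := ltnP (t + stride a) n.
  by rewrite modn_small // /cyclic_dist; lia.
(* The remaining arc is exactly one stride, so the step lands on offset 0. *)
move=> le_n; have e : t + stride a = n by lia.
by rewrite e modnn; move: lt; rewrite e subnn /cyclic_dist; lia.
Qed.

Definition vertex n (a : bool) (i : 'I_n) : 'I_n + 'I_n := if a then inr i else inl i.
Definition inner n (x : 'I_n + 'I_n) : bool := if x is inr _ then true else false.
Definition rim_index n (x : 'I_n + 'I_n) : 'I_n := match x with inl i | inr i => i end.
Definition offset n (x y : 'I_n + 'I_n) : nat := (rim_index x + (n - rim_index y)) %% n.

Lemma vertexK n (x : 'I_n + 'I_n) : vertex (inner x) (rim_index x) = x.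
Proof. by case: x. Qed.

Lemma petersen_arcP n (x z : 'I_n + 'I_n) : petersen_arc 3 x z ->
  inner z = ~~ inner x /\ rim_index z = rim_index x \/
  inner z = inner x /\ rim_index z = (rim_index x + stride (inner x)) %% n :> nat.
Proof. by case: x z => i [] j //= /eqP; [right | left | right]. Qed.

Lemma petersen_rim n a (i j : 'I_n) : j = (i + stride a) %% n :> nat ->
  petersen 3 (vertex a i) (vertex a j).
Proof. by case: a => /= e; rewrite /petersen /= e eqxx. Qed.

Lemma petersen_spoke n a (i : 'I_n) : petersen 3 (vertex a i) (vertex (~~ a) i).
Proof. by case: a; rewrite /petersen /= eqxx // orbT. Qed.

Lemma dist_petersen n (x y : 'I_n + 'I_n) : 20 <= n ->
  dist (@petersen n 3) x y = cyclic_dist n (inner x) (inner y) (offset x y).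
Proof.
move=> n20; have n0 : 0 < n by lia.
have offP z : offset z y < n by rewrite ltn_pmod.
move: x; apply: dist_eqP => [x|x z|x].
- rewrite (cyclic_dist0 _ _ (offP x)); split=> [[xy]|->].
    move=> off0; rewrite -(vertexK x) -(vertexK y) xy; congr vertex.
    apply/val_inj => /=.
    have : rim_index x + (n - rim_index y) = rim_index y + (n - rim_index y) %[mod n].
      by rewrite subnKC ?modnn // ltnW.
    by move/eqP; rewrite eqn_modDr !modn_small // => /eqP.
  by split=> //; rewrite /offset subnKC ?modnn // ltnW.
- have lip u v : petersen_arc 3 u v ->
      cyclic_dist n (inner u) (inner y) (offset u y)
        <= (cyclic_dist n (inner v) (inner y) (offset v y)).+1 /\
      cyclic_dist n (inner v) (inner y) (offset v y)
        <= (cyclic_dist n (inner u) (inner y) (offset u y)).+1.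
    case/petersen_arcP => -[-> e].
      rewrite /offset e; split; first exact: cyclic_dist_spoke.
      by rewrite -{2}[inner u]negbK; exact: cyclic_dist_spoke.
    have -> : offset v y = (offset u y + stride (inner u)) %% n.
      by rewrite /offset e !modnDml addnAC.
    exact: cyclic_dist_rim.
  by case/orP => /lip[].
- case/(cyclic_dist_desc (offP x)) => [lt|[st lt]|lt].
  + exists (vertex (~~ inner x) (rim_index x)).
      by rewrite -{1}(vertexK x); apply: petersen_spoke.
    by case: (x) lt.
  + pose j := Ordinal (ltn_pmod (rim_index x + (n - stride (inner x))) n0).
    have sn : stride (inner x) <= n by rewrite /stride; case: inner; lia.
    exists (vertex (inner x) j).
      rewrite petersen_sym -{2}(vertexK x); apply: petersen_rim.
      by rewrite /= modnDml -addnA subnK // modnDr modn_small.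
    have -> : inner (vertex (inner x) j) = inner x by case: (inner x).
    suff -> : offset (vertex (inner x) j) y = offset x y - stride (inner x) by [].
    have -> : offset (vertex (inner x) j) y = (offset x y + (n - stride (inner x))) %% n.
      by rewrite /offset; case: (inner x) @j => /=; rewrite !modnDml addnAC.
    by rewrite addnBA // -addnBAC // modnDr modn_small //; have := offP x; lia.
  + pose j := Ordinal (ltn_pmod (rim_index x + stride (inner x)) n0).
    exists (vertex (inner x) j).
      by rewrite -{1}(vertexK x); apply: petersen_rim.
    have -> : inner (vertex (inner x) j) = inner x by case: (inner x).
    suff -> : offset (vertex (inner x) j) y = (offset x y + stride (inner x)) %% n by [].
    by rewrite /offset; case: (inner x) @j => /=; rewrite !modnDml addnAC.
Qed.

(** * The two windows and the finite case k = 6 *)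

(** The sum of truncated differences is the absolute difference of the indices. *)
Definition position_dist (n : nat) (w x : bool * nat) : nat :=
  cyclic_dist n x.1 w.1 ((x.2 - w.2) + (w.2 - x.2)).

(* A landmark is put at index 3, in the middle of the near window {0, ..., 6};
   its antipode 3k + 5 is then the middle of the far window. *)
Definition window_position (k : nat) (far : bool) (x : bool * nat) : bool * nat :=
  (x.1, if far then 3 * k + 2 + x.2 else x.2).

Definition window_unresolved (k : nat) (w : bool * nat)
    (c : bool * ((bool * nat) * (bool * nat))) : bool :=
  let n := 6 * k + 4 in
  position_dist n w (window_position k c.1 c.2.1)
    == position_dist n w (window_position k c.1 c.2.2).

(* Pairs (window, (x, y)) not resolved by the landmark of type a at index 3,
   found by a computer search for k = 6. *)
Definition window_pairs (a : bool) : seq (bool * ((bool * nat) * (bool * nat))) :=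
  let u p := (false, p) in let v p := (true, p) in
  if a then
    [:: (false, (u 0, u 2)); (false, (u 0, u 4)); (false, (u 1, u 5));
        (false, (u 2, u 4)); (false, (u 2, u 6)); (false, (u 4, u 6));
        (true, (u 0, u 2)); (true, (u 0, u 4)); (true, (u 1, u 5));
        (true, (u 1, v 2)); (true, (u 1, v 4)); (true, (u 2, u 6));
        (true, (u 4, u 6)); (true, (v 2, u 5)); (true, (v 2, v 4));
        (true, (v 4, u 5))]
  else
    [:: (false, (u 1, v 2)); (false, (u 1, v 4)); (false, (v 2, u 5));
        (false, (v 2, v 4)); (false, (v 4, u 5));
        (true, (u 0, u 2)); (true, (u 0, v 3)); (true, (u 1, v 2));
        (true, (u 2, u 4)); (true, (u 2, v 3)); (true, (u 4, u 6));
        (true, (v 3, u 4)); (true, (v 3, u 6)); (true, (v 4, u 5))].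

Lemma window_pairsP a c : c \in window_pairs a ->
  [/\ c.2.1 != c.2.2, c.2.1.2 < 7 & c.2.2.2 < 7].
Proof.
move=> c_in; apply/and3P; move: c c_in; apply/allP.
by case: a.
Qed.

Definition window_covers (k : nat) : Prop :=
  forall (a : bool) (w1 w2 : bool * nat), w1.2 < 6 * k + 4 -> w2.2 < 6 * k + 4 ->
  exists2 c, c \in window_pairs a &
    [&& window_unresolved k (a, 3) c, window_unresolved k w1 c
      & window_unresolved k w2 c].

Lemma window_covers6 : window_covers 6.
Proof.
(* Landmarks matter only through the pairs that they fail to resolve, so the
   search runs over the few distinct such profiles. *)
pose profile a w := [seq window_unresolved 6 w c | c <- window_pairs a].
pose vertices : seq (bool * nat) := [seq (a, i) | a <- [:: false; true], i <- iota 0 40].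
pose profiles a := undup [seq profile a w | w <- vertices].
have chk a : all (window_unresolved 6 (a, 3)) (window_pairs a) &&
    (let rs := profiles a in
     all (fun r1 => all (fun r2 => has (fun b => b.1 && b.2) (zip r1 r2)) rs) rs).
  by case: a; vm_compute.
have profP a w : w.2 < 40 -> profile a w \in profiles a.
  move=> w40; rewrite mem_undup; apply: map_f; apply/allpairsP; exists w.
  by rewrite mem_iota w40; split=> //; case: w {w40} => -[].
move=> a w1 w2 /(profP a) p1 /(profP a) p2.
have /andP[/allP c0 /allP/(_ _ p1)/allP/(_ _ p2)] := chk a.
(* Both profiles follow the order of [window_pairs a], so a common true entry is a common unresolved
   pair. *)
rewrite zip_map has_map => /hasP[c c_in /andP[/= c1 c2]].
by exists c; rewrite ?c0 ?c1.
Qed.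

(** * Passing from k to k + 1 *)

(** The arc [t] is shorter by at least 10, so it gives the minimum both before and after the other
    arc grows. *)
Lemma cyclic_distD6 n a b t : 2 * t + 10 <= n ->
  cyclic_dist (n + 6) a b t = cyclic_dist n a b t.
Proof.
move=> tn; rewrite /cyclic_dist.
have := @linear_dist_le a b t (n - t) ltac:(lia).
have := @linear_dist_le a b t (n + 6 - t) ltac:(lia).
lia.
Qed.

Lemma cyclic_distD3 n a b t : 3 <= t -> t + 3 <= n ->
  cyclic_dist (n + 6) a b (t + 3) = (cyclic_dist n a b t).+1.
Proof.
move=> t3 tn; rewrite /cyclic_dist.
have -> : n + 6 - (t + 3) = n - t + 3 by lia.
by rewrite !linear_distD3; lia.
Qed.

Lemma cyclic_distD6_far n a b t : n + 10 <= 2 * t -> t <= n ->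
  cyclic_dist (n + 6) a b (t + 6) = cyclic_dist n a b t.
Proof.
move=> nt tn; rewrite -cyclic_distC; last lia.
rewrite -[RHS]cyclic_distC //.
by rewrite -[RHS]cyclic_distD6; [congr cyclic_dist; lia | lia].
Qed.

(* The graph for k + 1 has three more indices after 13 and three more after
   3k + 15. The cuts stay clear of both windows: the distances from a landmark
   to the vertices of one window then all change by the same amount. *)
Definition contract (k i : nat) : nat :=
  if i <= 13 then i else if i <= 3 * k + 18 then i - 3 else i - 6.

(** If the insertions lengthen both arcs from landmark to window by 3, then [d = 1]; if both fall on
    the longer arc, then [d = 0]. The margin 10 is met with equality at [i = 14] (far window) and
    [i = 3 * k + 19] (near window). *)
Lemma position_dist_contract k i far : 6 <= k -> i < 6 * k.+1 + 4 ->
  exists d, forall a x, x.2 < 7 ->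
    position_dist (6 * k.+1 + 4) (a, i) (window_position k.+1 far x)
      = d + position_dist (6 * k + 4) (a, contract k i) (window_position k far x).
Proof.
move=> k6 i_n; have -> : 6 * k.+1 + 4 = 6 * k + 4 + 6 by lia.
have near t t' a b : t' = t -> 2 * t + 10 <= 6 * k + 4 ->
    cyclic_dist (6 * k + 4 + 6) a b t' = 0 + cyclic_dist (6 * k + 4) a b t.
  by move=> ->; exact: cyclic_distD6.
have mid t t' a b : t' = t + 3 -> 3 <= t -> t + 3 <= 6 * k + 4 ->
    cyclic_dist (6 * k + 4 + 6) a b t' = 1 + cyclic_dist (6 * k + 4) a b t.
  by move=> ->; exact: cyclic_distD3.
have opp t t' a b : t' = t + 6 -> 6 * k + 4 + 10 <= 2 * t -> t <= 6 * k + 4 ->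
    cyclic_dist (6 * k + 4 + 6) a b t' = 0 + cyclic_dist (6 * k + 4) a b t.
  by move=> ->; exact: cyclic_distD6_far.
rewrite /contract /position_dist /window_position /=.
have [i13|i13] := leqP i 13; last have [ik|ik] := leqP i (3 * k + 18).
- case: far; [exists 1 | exists 0] => a [b p] /= p7.
    by apply: mid; lia.
  by apply: near; lia.
- case: far; [exists 0 | exists 1] => a [b p] /= p7.
    by apply: near; lia.
  by apply: mid; lia.
- case: far; [exists 1 | exists 0] => a [b p] /= p7.
    by apply: mid; lia.
  by apply: opp; lia.
Qed.

Lemma window_unresolved_contract k a w c : 6 <= k -> w.2 < 6 * k.+1 + 4 ->
  c \in window_pairs a ->
  window_unresolved k (w.1, contract k w.2) c -> window_unresolved k.+1 w c.
Proof.
case: w => b i /= k6 i_n /window_pairsP[_ x7 y7].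
have [d dE] := position_dist_contract c.1 k6 i_n.
by rewrite /window_unresolved !dE // eqn_add2l.
Qed.

Lemma window_coversP k : 6 <= k -> window_covers k.
Proof.
elim: k => // k IHk; rewrite leq_eqVlt => /predU1P[<-|k6]; first exact: window_covers6.
move=> a w1 w2 w1n w2n.
have cn i : i < 6 * k.+1 + 4 -> contract k i < 6 * k + 4.
  by rewrite /contract; case: (leqP i 13) => ?; last case: (leqP i) => ?; lia.
have [c c_in /and3P[ca c1 c2]] := IHk k6 a (w1.1, contract k w1.2)
  (w2.1, contract k w2.2) (cn _ w1n) (cn _ w2n).
have up := window_unresolved_contract k6 _ c_in.
(* [contract k] fixes 3, so the first landmark stays in place. *)
by exists c; rewrite // (up (a, 3)) ?(up w1) ?(up w2) //=; lia.
Qed.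

(** * Arbitrary landmarks and the lower bound *)

Lemma petersen_unresolved k (w0 w1 w2 : 'I_(6 * k + 4) + 'I_(6 * k + 4)) : 6 <= k ->
  exists x y, x != y /\ forall w, w \in [:: w0; w1; w2] ->
    dist (@petersen _ 3) x w = dist (@petersen _ 3) y w.
Proof.
set n := 6 * k + 4 in w0 w1 w2 *; move=> k6.
have n0 : 0 < n by rewrite /n; lia.
have n20 : 20 <= n by rewrite /n; lia.
(* [rot] carries [w0] to index 3 and [unrot] rotates back; the added [n] keeps the subtractions
   exact. *)
pose rot (w : 'I_n + 'I_n) := (inner w, (rim_index w + (n + 3 - rim_index w0)) %% n).
pose unrot (x : bool * nat) : 'I_n + 'I_n :=
  vertex x.1 (Ordinal (ltn_pmod (x.2 + (rim_index w0 + (n - 3))) n0)).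
have rotK w x : x.2 < n ->
    dist (@petersen n 3) (unrot x) w = position_dist n (rot w) x.
  case: x => b p /= pn; rewrite dist_petersen // /position_dist /=.
  have -> : inner (unrot (b, p)) = b by case: (b).
  set j := (rim_index w + _) %% n.
  have jn : j < n by rewrite ltn_pmod.
  have -> : offset (unrot (b, p)) w = (p + (n - j)) %% n.
    have index_unrot : rim_index (unrot (b, p)) = (p + (rim_index w0 + (n - 3))) %% n :> nat.
      by rewrite /unrot; case: (b).
    apply/eqP; rewrite /offset index_unrot modnDml -(eqn_modDr j).
    have -> : p + (n - j) + j = p + n by lia.
    rewrite modnDr /j modnDmr.
    have -> : p + (rim_index w0 + (n - 3)) + (n - rim_index w)
        + (rim_index w + (n + 3 - rim_index w0)) = p + 3 * n.
      by have := ltn_ord (rim_index w); have := ltn_ord (rim_index w0); lia.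
    by rewrite addnC modnMDl.
  have [pj|jp] := ltnP p j.
    rewrite modn_small; last lia.
    by rewrite -cyclic_distC; [congr cyclic_dist; lia | lia].
  have -> : p + (n - j) = n + (p - j) by rewrite addnBA 1?ltnW // addnC addnBA.
  by rewrite modnDl modn_small; [congr cyclic_dist; lia | lia].
have rot0 : rot w0 = (inner w0, 3).
  by rewrite /rot subnKC ?modnDl ?modn_small //; have := ltn_ord (rim_index w0); lia.
have [c c_in] := @window_coversP k k6 (inner w0) (rot w1) (rot w2)
  (ltn_pmod _ n0) (ltn_pmod _ n0).
rewrite -rot0 => /and3P[/eqP e0 /eqP e1 /eqP e2].
have [xy x7 y7] := window_pairsP c_in.
have win z : z.2 < 7 -> (window_position k c.1 z).2 < n.
  by rewrite /window_position /n /=; case: c.1; lia.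
exists (unrot (window_position k c.1 c.2.1)), (unrot (window_position k c.1 c.2.2)).
split=> [|w]; last by rewrite !inE !rotK ?win // => /or3P[] /eqP ->.
apply: contra_neq xy; case: c.2.1 c.2.2 x7 y7 => a p [b q] /= p7 q7 eq_rot.
have eq_ab : a = b by move/(congr1 (@inner n)): eq_rot; case: (a) (b) => -[].
move/(congr1 (fun x => rim_index x : nat)): eq_rot.
rewrite /unrot /window_position /= eq_ab.
have vertex_index i : rim_index (vertex b i) = i :> 'I_n by case: (b).
rewrite !vertex_index /= => /eqP; rewrite eqn_modDr !modn_small;
  try by rewrite /n; case: c.1; lia.
by move/eqP => pq; congr pair; move: pq; case: c.1; lia.
Qed.

Theorem theorem2 (n k : nat) (hn : n = 6 * k + 4) (hk : 6 <= k) :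
  4 <= metric_dim (@petersen n 3).
Proof.
subst n; rewrite /metric_dim.
case: ex_minnP => m /existsP[W /andP[_ /injectiveP W_inj]] _.
rewrite leqNgt ltnS; apply/negP => m3.
have n0 : 0 < 6 * k + 4 by lia.
(* If [W] has fewer than three entries, a default vertex pads it; only agreement on members of [W]
   is used. *)
pose w i := nth (inl (Ordinal n0)) W i.
have [x [y [xy xyW]]] := petersen_unresolved (w 0) (w 1) (w 2) hk.
case/eqP: xy; apply: W_inj; apply/eq_in_map => z zW; apply: xyW.
rewrite -(nth_index (inl (Ordinal n0)) zW).
have : index z W < 3 by apply: leq_trans m3; rewrite -[leqRHS](size_tuple W) index_mem.
by case: index => [|[|[|]]] // _; rewrite !inE eqxx ?orbT.
Qed.
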